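(* Let $\mathcal{G}$ and $\mathcal{G}^{\mathcal{W}}$ be switching equivalent signed graphs with adjacency matrices $A$ and $A^{\mathcal{W}}$ and with switching matrix $\Theta$. Consider on each graph the opinion dynamics with uniform $u_i=u\ge0$ for all $i=1,\dots,N$: $$\dot{\mathbf{x}}=-d\,\mathbf{x}+u\,S(\alpha\mathbf{x}+\gamma A\mathbf{x})\ \text{ on }\mathcal{G},\qquad \dot{\mathbf{x}}=-d\,\mathbf{x}+u\,S(\alpha\mathbf{x}+\gamma A^{\mathcal{W}}\mathbf{x})\ \text{ on }\mathcal{G}^{\mathcal{W}}.$$ Suppose $\mathcal{G}$ satisfies the pitchfork conditions: its adjacency matrix has a simple, real largest eigenvalue $\lambda^*$, $\alpha+\gamma\lambda^*>0$, and $\langle\mathbf{w}^*,(\mathbf{v}^* )^3\rangle>0$. Then $\mathcal{G}^{\mathcal{W}}$ also satisfies the pitchfork conditions (with its own adjacency matrix, leading eigenvalue, and eigenvectors). Furthermore, $\mathbf{x}^*$ is an equilibrium on the bifurcation diagram of the dynamics on $\mathcal{G}$ at some $u$ if and only if $\Theta\mathbf{x}^*$ is an equilibrium on the bifurcation diagram of the dynamics on $\mathcal{G}^{\mathcal{W}}$ at the same $u$.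
   Context: A signed graph $\mathcal{G}=(\mathcal{V},\mathcal{E},\sigma)$ has vertex set $\mathcal{V}=\{1,\dots,N\}$, directed edge set $\mathcal{E}$ ($e_{ik}$ points from $i$ to $k$), and signature $\sigma:\mathcal{E}\to\{1,-1\}$; the underlying directed graph is simple (no self-loops, at most one edge from $i$ to $k$). The signed adjacency matrix $A=(a_{ik})$ has $a_{ik}=\sigma(e_{ik})$ if $e_{ik}\in\mathcal{E}$ and $a_{ik}=0$ otherwise. For $\mathcal{W}\subset\mathcal{V}$, the switching function is $\theta:\mathcal{V}\to\{1,-1\}$ with $\theta(i)=-1$ if $i\in\mathcal{W}$ and $\theta(i)=1$ otherwise. Switching $\mathcal{W}$ on $\mathcal{G}$ produces $\mathcal{G}^{\mathcal{W}}=(\mathcal{V},\mathcal{E},\sigma_{\mathcal{W}})$ with $\sigma_{\mathcal{W}}(e_{ik})=\theta(i)\sigma(e_{ik})\theta(k)$ for all $e_{ik}\in\mathcal{E}$. Then $\mathcal{G}$ and $\mathcal{G}^{\mathcal{W}}$ are called switching equivalent. The switching matrix is $\Theta=\operatorname{diag}(\theta(1),\dots,\theta(N))$, and $A^{\mathcal{W}}=\Theta^{-1}A\Theta$ with $\Theta^{-1}=\Theta$. For an adjacency matrix, $\lambda^*$ denotes, when it exists, the real and unique eigenvalue with $\operatorname{Re}(\lambda^* )>\operatorname{Re}(\lambda_i)$ for all other eigenvalues $\lambda_i\ne\lambda^*$; $\mathbf{v}^*,\mathbf{w}^*$ are its right and left eigenvectors, normalized so that $\langle\mathbf{w}^*,\mathbf{v}^*\rangle=1$;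 $(\mathbf{v}^* )^3$ is the entrywise cube. In the dynamics, $\mathbf{x}\in\mathbb{R}^N$, $d>0$, $\alpha\ge0$, $\gamma>0$; $S(\mathbf{y}):=(S(y_1),\dots,S(y_N))$ where $S:\mathbb{R}\to\mathbb{R}$ is a smooth, odd, saturating (bounded) function with $S(0)=0$, $S'(0)=1$, $\operatorname{sign}(S''(x))=-\operatorname{sign}(x)$. The bifurcation diagram is the set of pairs $(\mathbf{x},u)$ such that $\mathbf{x}$ is an equilibrium of the dynamics with parameter $u$. *)

(* Defs.v *)
From HB Require Import structures.
From mathcomp Require Import all_boot all_order all_algebra.
From mathcomp Require Import complex.
From mathcomp Require Import all_classical all_reals all_analysis.
Set Implicit Arguments.
Unset Strict Implicit.
Unset Printing Implicit Defensive.
Import Order.TTheory GRing.Theory Num.Theory.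
Local Open Scope ring_scope.

(* The values of [signature] off the edge set carry no meaning: no notion
   below depends on them. *)
Record signedGraph (N : nat) := SignedGraph {
  edge : rel 'I_N;
  signature : 'I_N -> 'I_N -> int;
  edge_irrefl : irreflexive edge;
  signatureP : forall i k, edge i k -> signature i k \in [:: 1; -1]
}.

Definition adjacency (R : realType) (N : nat) (G : signedGraph N) : 'M[R]_N :=
  \matrix_(i, k) (if edge G i k then (signature G i k)%:~R else 0).

Definition switching_fun (N : nat) (W : {set 'I_N}) (i : 'I_N) : int :=
  if i \in W then -1 else 1.

Definition switched_signature (N : nat) (G : signedGraph N) (W : {set 'I_N})
    (i k : 'I_N) : int :=
  switching_fun W i * signature G i k * switching_fun W k.

Lemma switched_signatureP (N : nat) (G : signedGraph N) (W : {set 'I_N}) i k :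
  edge G i k -> switched_signature G W i k \in [:: 1; -1].
Proof.
move=> /signatureP; rewrite /switched_signature /switching_fun !inE.
by case/orP => /eqP ->; case: (i \in W); case: (k \in W).
Qed.

Definition switch (N : nat) (G : signedGraph N) (W : {set 'I_N}) :
    signedGraph N :=
  SignedGraph (@edge_irrefl N G) (@switched_signatureP N G W).

Definition switching_matrix (R : realType) (N : nat) (W : {set 'I_N}) :
    'M[R]_N :=
  diag_mx (\row_i (switching_fun W i)%:~R).

(* The spectrum of a real matrix is its complex spectrum. *)
Definition complexify (R : realType) (N : nat) (A : 'M[R]_N) : 'M[R[i]]_N :=
  map_mx (real_complex R) A.

Definition is_leading_eigenvalue (R : realType) (N : nat) (A : 'M[R]_N)
    (lam : R) : Prop :=
  eigenvalue (complexify A) (real_complex R lam) /\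
  forall mu : R[i], eigenvalue (complexify A) mu ->
    mu != real_complex R lam -> complex.Re mu < lam.

(* Simple means algebraic multiplicity one. *)
Definition is_simple_eigenvalue (R : realType) (N : nat) (A : 'M[R]_N)
    (lam : R) : Prop :=
  mup (real_complex R lam) (char_poly (complexify A)) = 1%N.

Definition right_eigenvector (R : realType) (N : nat) (A : 'M[R]_N) (lam : R)
    (v : 'cV[R]_N) : Prop :=
  v != 0 /\ A *m v = lam *: v.

Definition left_eigenvector (R : realType) (N : nat) (A : 'M[R]_N) (lam : R)
    (w : 'cV[R]_N) : Prop :=
  w != 0 /\ w^T *m A = lam *: w^T.

Definition inner (R : realType) (N : nat) (x y : 'cV[R]_N) : R :=
  \sum_i x i 0 * y i 0.

Definition cube (R : realType) (N : nat) (v : 'cV[R]_N) : 'cV[R]_N :=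
  map_mx (fun t => t ^+ 3) v.

(* The leading eigenvalue is unique and simple, so (v, w) is determined up to
   (c v, c^-1 w) with c != 0, which multiplies the last quantity by c ^+ 2:
   the condition does not depend on the choice of the eigenvectors. *)
Definition pitchfork_conditions (R : realType) (N : nat) (alpha gamma : R)
    (A : 'M[R]_N) : Prop :=
  exists (lam : R) (v w : 'cV[R]_N),
    [/\ is_leading_eigenvalue A lam /\ is_simple_eigenvalue A lam,
        right_eigenvector A lam v /\ left_eigenvector A lam w,
        inner w v = 1,
        0 < alpha + gamma * lam &
        0 < inner w (cube v)].

Record saturating_function (R : realType) (S : R -> R) : Prop := {
  saturating_smooth : forall (n : nat) (x : R), derivable (derive1n n S) x 1;
  saturating_odd : forall x : R, S (- x) = - S x;
  saturating_bounded : exists M : R, forall x : R, `|S x| <= M;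
  saturating_at0 : S 0 = 0;
  saturating_slope0 : derive1n 1 S 0 = 1;
  saturating_concavity : forall x : R, Num.sg (derive1n 2 S x) = - Num.sg x
}.

Definition opinion_field (R : realType) (N : nat) (S : R -> R)
    (d alpha gamma : R) (A : 'M[R]_N) (u : R) (x : 'cV[R]_N) : 'cV[R]_N :=
  - d *: x + u *: map_mx S (alpha *: x + gamma *: (A *m x)).

Definition is_equilibrium (R : realType) (N : nat)
    (F : 'cV[R]_N -> 'cV[R]_N) (x : 'cV[R]_N) : Prop :=
  F x = 0.

(* The parameter u ranges over the nonnegative reals. *)
Definition bifurcation_diagram (R : realType) (N : nat) (S : R -> R)
    (d alpha gamma : R) (A : 'M[R]_N) : set ('cV[R]_N * R) :=
  [set p | 0 <= p.2 /\
           is_equilibrium (opinion_field S d alpha gamma A p.2) p.1]%classic.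

(* Main.v *)
Require Import Defs.
From HB Require Import structures.
From mathcomp Require Import all_boot all_order all_algebra.
From mathcomp Require Import complex.
From mathcomp Require Import all_classical all_reals all_analysis.
Import Order.TTheory GRing.Theory Num.Theory.
Local Open Scope ring_scope.
Local Open Scope classical_set_scope.

(** Switching conjugates the adjacency matrix by the switching matrix [T]
    ([adjacency_switch]), a diagonal matrix of signs, which is its own inverse
    ([switching_matrixK]).  Conjugate matrices have the same characteristic
    polynomial ([char_poly_conj]), so the leading eigenvalue and its algebraic
    multiplicity are unchanged.  If [v] and [w] are right and left leading
    eigenvectors, so are [T v] and [T w] for the switched matrix, and
    multiplication by [T] preserves the inner product.  An odd function applied
    entrywise commutes with [T] ([map_mx_switching]).  For the cube, this gives
    that the cubic coefficient of the pitchfork conditions is unchanged; for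
    the saturating function, that [T] intertwines the two vector fields
    ([opinion_field_switch]) and hence, being invertible, matches their
    zeros. *)

Lemma char_poly_conj (F : comNzRingType) (n : nat) (P A : 'M[F]_n) :
  P *m P = 1%:M -> char_poly (P *m A *m P) = char_poly A.
Proof.
move=> PP; pose Q := map_mx polyC P.
have QQ : Q *m Q = 1%:M by rewrite -map_mxM PP map_mx1.
rewrite /char_poly; have -> : char_poly_mx (P *m A *m P) = Q *m char_poly_mx A *m Q.
  rewrite /char_poly_mx mulmxBr mulmxBl !map_mxM -/Q; congr (_ - _).
  by rewrite mul_mx_scalar -scalemxAl QQ scalemx1.
by rewrite !det_mulmx mulrAC -det_mulmx QQ det1 mul1r.
Qed.

Section Spectrum.
Set Implicit Arguments.
Unset Strict Implicit.
Variables (R : realType) (N : nat) (A B : 'M[R]_N) (lam : R).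
Hypothesis eqAB : char_poly A = char_poly B.

Lemma char_poly_complexify :
  char_poly (complexify A) = char_poly (complexify B).
Proof. by rewrite /complexify -!map_char_poly eqAB. Qed.

Lemma is_leading_eigenvalue_char_poly :
  is_leading_eigenvalue A lam -> is_leading_eigenvalue B lam.
Proof.
case=> ev dom; split=> [|mu].
  by rewrite eigenvalue_root_char -char_poly_complexify -eigenvalue_root_char.
rewrite eigenvalue_root_char -char_poly_complexify -eigenvalue_root_char.
exact: dom.
Qed.

Lemma is_simple_eigenvalue_char_poly :
  is_simple_eigenvalue A lam -> is_simple_eigenvalue B lam.
Proof. by rewrite /is_simple_eigenvalue char_poly_complexify. Qed.

End Spectrum.

Section Switching.
Set Implicit Arguments.
Unset Strict Implicit.
Variables (R : realType) (N : nat) (W : {set 'I_N}).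

Local Notation theta i := ((switching_fun W i)%:~R : R).
Local Notation T := (switching_matrix R W).

Lemma switching_fun_cases (i : 'I_N) : theta i = 1 \/ theta i = -1.
Proof. by rewrite /switching_fun; case: ifP => _; [right|left]. Qed.

Lemma switching_fun_sqr (i : 'I_N) : theta i * theta i = 1.
Proof. by case: (switching_fun_cases i) => ->; rewrite ?mulrNN mulr1. Qed.

Lemma switching_matrixE (n : nat) (X : 'M[R]_(N, n)) i j :
  (T *m X) i j = theta i * X i j.
Proof. by rewrite mul_diag_mx !mxE. Qed.

Lemma tr_switching_matrix : T^T = T.
Proof. exact: tr_diag_mx. Qed.

Lemma switching_matrixK : T *m T = 1%:M.
Proof.
apply/matrixP=> i j; rewrite switching_matrixE !mxE mulrnAr.
have [->|_] := eqVneq i j; last by rewrite !mulr0n.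
by rewrite switching_fun_sqr.
Qed.

Lemma switching_matrix_eq0 (n : nat) (X : 'M[R]_(N, n)) :
  (T *m X == 0) = (X == 0).
Proof.
apply/eqP/eqP=> [TX0|->]; last exact: mulmx0.
by rewrite -[X]mul1mx -switching_matrixK -mulmxA TX0 mulmx0.
Qed.

Lemma adjacency_switch (G : signedGraph N) :
  adjacency R (switch G W) = T *m adjacency R G *m T.
Proof.
apply/matrixP=> i k; rewrite mul_mx_diag [RHS]mxE switching_matrixE !mxE /=.
by case: ifP => _; rewrite ?mulr0 ?mul0r // /switched_signature !intrM.
Qed.

Lemma inner_switching (x y : 'cV[R]_N) : inner (T *m x) (T *m y) = inner x y.
Proof.
apply: eq_bigr => i _.
by rewrite !switching_matrixE mulrACA switching_fun_sqr mul1r.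
Qed.

Lemma map_mx_switching (f : R -> R) (y : 'cV[R]_N) :
  (forall t, f (- t) = - f t) -> map_mx f (T *m y) = T *m map_mx f y.
Proof.
move=> f_odd; apply/matrixP=> i j.
rewrite [LHS]mxE !switching_matrixE [in RHS]mxE.
by case: (switching_fun_cases i) => ->; rewrite ?mul1r ?mulN1r.
Qed.

Lemma cube_switching (v : 'cV[R]_N) : cube (T *m v) = T *m cube v.
Proof. by apply: map_mx_switching => t; rewrite exprNn -signr_odd mulN1r. Qed.

Lemma right_eigenvector_switching (A : 'M[R]_N) (lam : R) (v : 'cV[R]_N) :
  right_eigenvector A lam v -> right_eigenvector (T *m A *m T) lam (T *m v).
Proof.
case=> v0 Av; split; first by rewrite switching_matrix_eq0.
by rewrite -!mulmxA (mulmxA T T) switching_matrixK mul1mx Av -scalemxAr.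
Qed.

Lemma left_eigenvector_switching (A : 'M[R]_N) (lam : R) (w : 'cV[R]_N) :
  left_eigenvector A lam w -> left_eigenvector (T *m A *m T) lam (T *m w).
Proof.
case=> w0 wA; split; first by rewrite switching_matrix_eq0.
rewrite trmx_mul tr_switching_matrix !mulmxA -(mulmxA _ T T).
by rewrite switching_matrixK mulmx1 wA -scalemxAl.
Qed.

Lemma pitchfork_conditions_switching (alpha gamma : R) (A : 'M[R]_N) :
  pitchfork_conditions alpha gamma A ->
  pitchfork_conditions alpha gamma (T *m A *m T).
Proof.
case=> lam [v [w [[lead simp] [rv lw] wv1 pos cub]]].
have eqA : char_poly A = char_poly (T *m A *m T).
  by rewrite char_poly_conj // switching_matrixK.
exists lam, (T *m v), (T *m w); split.
- split; first exact: is_leading_eigenvalue_char_poly eqA lead.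
  exact: is_simple_eigenvalue_char_poly eqA simp.
- split; first exact: right_eigenvector_switching.
  exact: left_eigenvector_switching.
- by rewrite inner_switching.
- exact: pos.
- by rewrite cube_switching inner_switching.
Qed.

Lemma opinion_field_switch (S : R -> R) (d alpha gamma u : R) (A : 'M[R]_N)
    (x : 'cV[R]_N) : (forall t, S (- t) = - S t) ->
  opinion_field S d alpha gamma (T *m A *m T) u (T *m x) =
  T *m opinion_field S d alpha gamma A u x.
Proof.
move=> S_odd; rewrite /opinion_field mulmxDr -!scalemxAr.
rewrite -map_mx_switching // mulmxDr -!scalemxAr.
by rewrite -!mulmxA (mulmxA T T) switching_matrixK mul1mx.
Qed.

End Switching.

Theorem mainTheorem5 (R : realType) (N : nat) (G : signedGraph N)
    (W : {set 'I_N}) (S : R -> R) (d alpha gamma : R)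
    (hS : saturating_function S)
    (hd : 0 < d) (halpha : 0 <= alpha) (hgamma : 0 < gamma)
    (hG : pitchfork_conditions alpha gamma (adjacency R G)) :
  pitchfork_conditions alpha gamma (adjacency R (switch G W)) /\
  forall (x : 'cV[R]_N) (u : R),
    bifurcation_diagram S d alpha gamma (adjacency R G) (x, u) <->
    bifurcation_diagram S d alpha gamma (adjacency R (switch G W))
      (switching_matrix R W *m x, u).
Proof.
rewrite adjacency_switch; split; first exact: pitchfork_conditions_switching.
move=> x u; rewrite /bifurcation_diagram /is_equilibrium /=.
rewrite (opinion_field_switch _ _ _ _ _ _ _ (saturating_odd hS)).
split=> -[u0 /eqP F0]; split=> //; apply/eqP.
  by rewrite switching_matrix_eq0.
by rewrite switching_matrix_eq0 in F0.
Qed.
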